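(* Let $A\in\mathbb R^{n\times n}$ and $B\in\mathbb R^{n\times m}$. The linear system $$\hat x^{+}=A(\hat x+Bu),\qquad \hat x\in\mathbb R^n,\ u\in\mathbb R^m,$$ is deadbeat controllable if and only if there exists $p\ge 1$ such that $[x]_{1-p}=\mathbb R^n$ for all $x\in\mathbb R^n$, where the sets $[x]_{-k}$ are defined in the context.
   Context: Sets: $\mathrm{range}(B)$ denotes the range space of $B$. For a set $\mathcal S\subset\mathbb R^n$, $A^{-1}\mathcal S:=\{v\in\mathbb R^n: Av\in\mathcal S\}$ (preimage; $A$ need not be invertible). For $x\in\mathbb R^n$ define $[x]_0:=x+\mathrm{range}(B)$ and, for $k=0,1,2,\ldots$, $[x]_{-k-1}:=A^{-1}\big([Ax]_{-k}\big)+\mathrm{range}(B)$, where $+$ denotes the sum of sets. (This is the specialization to $f(x)=Ax$, $\mu(x,u)=x+Bu$ of the general definition $[x]_0=\mu(x,\mathcal U)$, $[x]_{-k-1}=\mu(f^{-1}([f(x)]_{-k}),\mathcal U)$.) Deadbeat controllability: given a set-valued map $\kappa:\mathbb R^n\times\mathbb R^n\rightrightarrows\mathbb R^m$ with nonempty values, consider the coupled systems $x^{+}=Ax$, $\hat x^{+}\in A(\hat x+B\kappa(\hat x,x))$, where $^+$ denotes the state at the next time instant. Let $\phi(k,x)=A^kx$ be the solution of the first and $\psi(k,\hat x,x)$ a solution of the second at time $k$ for initial conditions $(\hat x,x)$. The map $\kappa$ is a deadbeat feedback law if there exists $q\ge 1$ such that all solutions satisfy $\psi(k,\hat x,x)=\phi(k,x)$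 for all $x,\hat x\in\mathbb R^n$ and all $k\ge q$. The system is deadbeat controllable if a deadbeat feedback law for it exists. *)

(* Defs.v *)
From mathcomp Require Export all_boot all_order all_algebra.
From mathcomp Require Export boolp classical_sets reals.

Set Implicit Arguments.
Unset Strict Implicit.
Unset Printing Implicit Defensive.

Import GRing.Theory.

Local Open Scope classical_set_scope.
Local Open Scope ring_scope.

Definition sumset (V : zmodType) (X Y : set V) : set V :=
  [set x + y | x in X & y in Y].

Section LinearSystem.
Variables (R : realType) (n m : nat) (A : 'M[R]_n) (B : 'M[R]_(n, m)).

Definition range_space : set 'cV[R]_n := range (fun u : 'cV[R]_m => B *m u).

(* [bracket k x] is the set written [x]_{-k}. *)
Fixpoint bracket (k : nat) (x : 'cV[R]_n) : set 'cV[R]_n :=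
  if k is k'.+1 then sumset (mulmx A @^-1` bracket k' (A *m x)) range_space
  else sumset [set x] range_space.

Definition phi (k : nat) (x : 'cV[R]_n) : 'cV[R]_n := A ^+ k *m x.

(* [xhat] solves the inclusion xhat^+ \in A (xhat + B kappa(xhat, x)) from
   [xhat0], driven by the solution of x^+ = A x from [x0]. *)
Definition is_solution (kappa : 'cV[R]_n -> 'cV[R]_n -> set 'cV[R]_m)
    (xhat0 x0 : 'cV[R]_n) (xhat : nat -> 'cV[R]_n) : Prop :=
  xhat 0%N = xhat0 /\
  forall k, [set A *m (xhat k + B *m u) | u in kappa (xhat k) (phi k x0)]
              (xhat k.+1).

Definition deadbeat_feedback_law
    (kappa : 'cV[R]_n -> 'cV[R]_n -> set 'cV[R]_m) : Prop :=
  (forall xhat x, kappa xhat x !=set0) /\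
  exists2 q : nat, (1 <= q)%N &
    forall (xhat0 x0 : 'cV[R]_n) (psi : nat -> 'cV[R]_n),
      is_solution kappa xhat0 x0 psi ->
      forall k, (q <= k)%N -> psi k = phi k x0.

Definition deadbeat_controllable : Prop :=
  exists kappa, deadbeat_feedback_law kappa.

End LinearSystem.

(* Main.v *)
(** The relation [bracket k x y] says that some input sequence steers the
    follower from [y] onto the point [x], moving along [x^+ = A x], within
    [k + 1] inputs.  A deadbeat law produces such inputs for every pair.
    Conversely, the brackets increase with [k], so an input descending from the
    smallest bracket containing [xhat] descends from all of them, and the law
    made of these inputs synchronises the two systems. *)

Require Import Defs.

Set Implicit Arguments.
Unset Strict Implicit.
Unset Printing Implicit Defensive.

Import GRing.Theory.

Local Open Scope classical_set_scope.
Local Open Scope ring_scope.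

(** The range of [B] is closed under negation: if [x] is displaced to [y] by [B *m u], the input
    [- u] leads back from [y] to [x]. *)
Lemma bracket0P (R : realType) (n m : nat) (A : 'M[R]_n) (B : 'M[R]_(n, m))
    (x y : 'cV[R]_n) :
  bracket A B 0 x y <-> exists u, y + B *m u = x.
Proof.
split=> [[_ -> [_ [u _ <-] <-]]|[u <-]].
  by exists (- u); rewrite mulmxN addrK.
exists (y + B *m u) => //; exists (B *m - u); first by exists (- u).
by rewrite mulmxN addrK.
Qed.

Lemma bracketSP (R : realType) (n m : nat) (A : 'M[R]_n) (B : 'M[R]_(n, m))
    (k : nat) (x y : 'cV[R]_n) :
  bracket A B k.+1 x y <->
  exists u, bracket A B k (A *m x) (A *m (y + B *m u)).
Proof.
split=> [[z /= xz [_ [u _ <-] <-]]|[u yu]].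
  by exists (- u); rewrite mulmxN addrK.
exists (y + B *m u) => //; exists (B *m - u); first by exists (- u).
by rewrite mulmxN addrK.
Qed.

Lemma bracket_refl (R : realType) (n m : nat) (A : 'M[R]_n) (B : 'M[R]_(n, m))
    (k : nat) (x : 'cV[R]_n) : bracket A B k x x.
Proof.
elim: k x => [|k IHk] x.
  by apply/bracket0P; exists 0; rewrite mulmx0 addr0.
by apply/bracketSP; exists 0; rewrite mulmx0 addr0.
Qed.

Lemma bracket_leq (R : realType) (n m : nat) (A : 'M[R]_n) (B : 'M[R]_(n, m))
    (j k : nat) (x : 'cV[R]_n) :
  (j <= k)%N -> bracket A B j x `<=` bracket A B k x.
Proof.
elim: k j x => [|k IHk] [|j] x // jk y; first by [].
  move=> /bracket0P[u yux]; apply/bracketSP; exists u.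
  by rewrite yux; exact: bracket_refl.
move=> /bracketSP[u yu]; apply/bracketSP; exists u.
exact: IHk jk _ yu.
Qed.

Lemma phiS (R : realType) (n : nat) (A : 'M[R]_n) (k : nat) (x : 'cV[R]_n) :
  phi A k.+1 x = A *m phi A k x.
Proof. by rewrite /phi exprS mulmxA. Qed.

Lemma solution_exists (R : realType) (n m : nat) (A : 'M[R]_n)
    (B : 'M[R]_(n, m)) (kappa : 'cV[R]_n -> 'cV[R]_n -> set 'cV[R]_m)
    (xhat0 x0 : 'cV[R]_n) :
  (forall xhat x, kappa xhat x !=set0) ->
  exists psi, is_solution A B kappa xhat0 x0 psi.
Proof.
move=> kappa_neq0.
pose input xhat x := projT1 (cid (kappa_neq0 xhat x)).
pose fix psi k := if k is k'.+1
  then A *m (psi k' + B *m input (psi k') (phi A k' x0)) else xhat0.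
exists psi; split=> // k; exists (input (psi k) (phi A k x0)) => //.
exact: projT2 (cid (kappa_neq0 _ _)).
Qed.

(** The inputs chosen along the solution from time [i] on are the witnesses that the bracket asks
    for; the last one is 0. The time [i] stays general because each step moves the base point along
    [phi]. *)
Lemma solution_bracket (R : realType) (n m : nat) (A : 'M[R]_n)
    (B : 'M[R]_(n, m)) (kappa : 'cV[R]_n -> 'cV[R]_n -> set 'cV[R]_m)
    (xhat0 x0 : 'cV[R]_n) (psi : nat -> 'cV[R]_n) (i k : nat) :
  is_solution A B kappa xhat0 x0 psi -> psi (i + k)%N = phi A (i + k) x0 ->
  bracket A B k (phi A i x0) (psi i).
Proof.
move=> [_ step]; elim: k i => [|k IHk] i.
  by rewrite addn0 => ->; exact: bracket_refl.
rewrite -addSnnS => /IHk; have [u _ <-] := step i.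
by rewrite phiS => ?; apply/bracketSP; exists u.
Qed.

(** Quantifying over all [k] avoids naming the smallest bracket. Outside all brackets both clauses
    are vacuous and every input is allowed. *)
Definition descent_law (R : realType) (n m : nat) (A : 'M[R]_n)
    (B : 'M[R]_(n, m)) (xhat x : 'cV[R]_n) : set 'cV[R]_m :=
  [set u | (bracket A B 0 x xhat -> xhat + B *m u = x) /\
    forall k, bracket A B k.+1 x xhat ->
      bracket A B k (A *m x) (A *m (xhat + B *m u))].

Lemma descent_law_neq0 (R : realType) (n m : nat) (A : 'M[R]_n)
    (B : 'M[R]_(n, m)) (xhat x : 'cV[R]_n) : descent_law A B xhat x !=set0.
Proof.
have [reach|unreach] := pselect (exists k, `[< bracket A B k x xhat >]); last first.
  by exists 0; split=> [?|k ?]; case: unreach; eexists; apply/asboolP; eassumption.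
case: (ex_minnP reach) => -[|k] /asboolP + kmin.
  move=> /bracket0P[u xu]; exists u; split=> // j _.
  by rewrite xu; exact: bracket_refl.
(* Minimality of [k.+1] excludes bracket 0 and forces [k <= j]. *)
move=> /bracketSP[u xu]; exists u; split=> [/asboolP/kmin//|j].
by move=> /asboolP/kmin kj; exact: (bracket_leq (j := k) kj) xu.
Qed.

Lemma descent_law_deadbeat (R : realType) (n m : nat) (A : 'M[R]_n)
    (B : 'M[R]_(n, m)) (xhat0 x0 : 'cV[R]_n) (psi : nat -> 'cV[R]_n)
    (N k : nat) :
  is_solution A B (descent_law A B) xhat0 x0 psi ->
  bracket A B N x0 xhat0 -> (N < k)%N -> psi k = phi A k x0.
Proof.
move=> [psi0 step] reach.
(* Truncated subtraction also covers [i > N]: from bracket 0 the law lands on the target, so the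
   states stay equal. *)
have descend i : bracket A B (N - i) (phi A i x0) (psi i).
  elim: i => [|i]; first by rewrite subn0 psi0 /phi expr0 mul1mx.
  have [u [u0 uS] <-] := step i.
  rewrite phiS subnS; case: (N - i)%N => [/u0 ->|j /uS //].
  exact: bracket_refl.
(* Bracket 0 gives equality only after one more input, hence [N < k]. *)
case: k => // k; rewrite ltnS => Nk.
have [u [u0 _] <-] := step k.
by rewrite phiS u0 //; have := descend k; rewrite (eqP Nk).
Qed.

Theorem theorem1 (R : realType) (n m : nat)
    (A : 'M[R]_n) (B : 'M[R]_(n, m)) :
  deadbeat_controllable A B <->
  exists2 p : nat, (1 <= p)%N &
    forall x : 'cV[R]_n, bracket A B p.-1 x = [set: 'cV[R]_n].
Proof.
split=> [[kappa [kappa_neq0 [q _ deadbeat]]]|[p p_gt0 full]].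
  (* With [p = q.+1] the index [p.-1] is the deadbeat time [q]. *)
  exists q.+1 => // x; apply/seteqP; split=> // y _.
  have [psi sol] := solution_exists A B y x kappa_neq0.
  have := solution_bracket (i := 0) sol (deadbeat _ _ _ sol q (leqnn q)).
  by rewrite sol.1 /phi expr0 mul1mx.
exists (descent_law A B); split; first exact: descent_law_neq0.
exists p => // xhat0 x0 psi sol k pk.
by apply: (descent_law_deadbeat (N := p.-1) sol); rewrite ?full ?prednK.
Qed.
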